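(* Let $H\subset\mathcal{M}_A$ be a Hall set. Then $\mathcal{A}$, as a commutative associative algebra under the shuffle product, is freely generated by the Hall integrals $\prec(h)$, $h\in H$: every element of $\mathcal{A}$ can be written uniquely as a shuffle polynomial in the Hall integrals $\{\prec(h)\}_{h\in H}$. Equivalently, the unital algebra homomorphism from the polynomial ring $\mathbb{R}[x_h: h\in H]$ to $(\mathcal{A},⧢)$ sending $x_h\mapsto\prec(h)$ is an isomorphism.
   Context: Let $A$ be a finite alphabet, $W_A$ the set of all words over $A$ including the empty word $e$, and $\mathcal{A}$ the real vector space with basis $W_A$; $\langle f,e\rangle$ is the coefficient of $e$ in $f$. Juxtaposition denotes concatenation, extended bilinearly. Half shuffle: $\prec:\mathcal{A}\times\mathcal{A}\to\mathcal{A}$ is the bilinear map determined on words by: $e\prec w=0$ for every word $w$; $u\prec e=u$ for every non-empty word $u$; $a\prec w=aw$ for every letter $a$ and word $w$; and recursively $(au)\prec w=a(u\prec w+w\prec u)$ for every letter $a$, non-empty word $u$ and word $w$. Shuffle product: $f ⧢ g=f\prec g+g\prec f+\langle f,e\rangle\langle g,e\rangle e$ (associative, commutative, unit $e$). Free magma: $\mathcal{M}_A$ is the smallest set containing $A$ and containing $(t',t'')$ whenever $t',t''\in\mathcal{M}_A$; degree $|a|=1$ for letters, $|(t',t'')|=|t'|+|t''|$. Define $\prec:\mathcal{M}_A\to\mathcal{A}$ recursively by $\prec(a)=a$ for $a\in A$ and $\prec((t',t''))=(\prec(t'))\prec(\prec(t''))$. Hall set: a subset $H\subset\mathcal{M}_A$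 with a total order $<$ such that (1) $t<t''$ for every $t=(t',t'')\in H$ of degree $\ge2$; (2) $A\subset H$; (3) for every tree $h=(h_1,h_2)\in\mathcal{M}_A$ of degree $\ge2$, $h\in H$ if and only if $h_1,h_2\in H$, $h_1<h_2$, and either $h_1\in A$ or $h_2\le h_1''$ where $h_1=(h_1',h_1'')$. A Hall integral is an element $\prec(h)$ with $h\in H$. *)

(* Defs.v *)
From HB Require Import structures.
From mathcomp Require Import all_boot all_order all_algebra.
From mathcomp Require Import finmap monalg.
From mathcomp Require Import boolp classical_sets reals.

Set Implicit Arguments.
Unset Strict Implicit.
Unset Printing Implicit Defensive.

Import GRing.Theory.
Local Open Scope ring_scope.

(* The bilinear extension of a map defined on pairs of words. *)
HB.lock Definition bilin (R : comNzRingType) (A : choiceType)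
    (phi : seq A -> seq A -> {malg R[seq A]}) (f g : {malg R[seq A]}) :
    {malg R[seq A]} :=
  \sum_(u <- msupp f) \sum_(w <- msupp g) (f@_u * g@_w) *: phi u w.

Arguments bilin {R A} phi f g.

Section HalfShuffle.
Variables (R : comNzRingType) (A : choiceType).
Local Notation V := {malg R[seq A]}.
Implicit Types (f g h : V) (u v w : seq A) (a b : A) (c : R).

Definition concat : V -> V -> V := bilin (fun u w => << u ++ w >>).

(* The recursion swaps the two words, so it is run with fuel [n], which
   suffices as soon as [size u + size w <= n]; the defining equations are
   [half_shuffle_nil] to [half_shuffle_cons] below. *)
Fixpoint half_shuffle_rec (n : nat) u w : V :=
  if n isn't n'.+1 then 0 else
  match u, w with
  | [::], _ => 0
  | _, [::] => << u >>
  | [:: a], _ => << a :: w >>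
  | a :: u', _ =>
      concat << [:: a] >> (half_shuffle_rec n' u' w + half_shuffle_rec n' w u')
  end.

Definition half_shuffle_word u w : V :=
  half_shuffle_rec (size u + size w) u w.

Definition half_shuffle : V -> V -> V := bilin half_shuffle_word.

Definition shuffle f g : V :=
  half_shuffle f g + half_shuffle g f
  + << f@_([::] : seq A) * g@_([::] : seq A) *g ([::] : seq A) >>.

Lemma bilinE phi (d1 d2 : {fset seq A}) f g :
    (msupp f `<=` d1)%fset -> (msupp g `<=` d2)%fset ->
  bilin phi f g = \sum_(u <- d1) \sum_(w <- d2) (f@_u * g@_w) *: phi u w.
Proof.
move=> le1 le2; rewrite bilin.unlock (big_fset_incl _ le1) /=.
  apply/eq_bigr => u _; apply/big_fset_incl => // w _ /mcoeff_outdom ->.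
  by rewrite mulr0 scale0r.
move=> u _ /mcoeff_outdom fu; rewrite big1 // => w _.
by rewrite fu mul0r scale0r.
Qed.

Lemma bilinPl phi c f1 f2 g :
  bilin phi (c *: f1 + f2) g = c *: bilin phi f1 g + bilin phi f2 g.
Proof.
pose d := (msupp (c *: f1 + f2) `|` (msupp f1 `|` msupp f2))%fset.
have l0 : (msupp (c *: f1 + f2) `<=` d)%fset by exact: fsubsetUl.
have l1 : (msupp f1 `<=` d)%fset.
  by apply: fsubset_trans (fsubsetUr _ _); exact: fsubsetUl.
have l2 : (msupp f2 `<=` d)%fset.
  by apply: fsubset_trans (fsubsetUr _ _); exact: fsubsetUr.
have lg := fsubset_refl (msupp g).
rewrite (bilinE phi l0 lg) (bilinE phi l1 lg) (bilinE phi l2 lg).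
rewrite scaler_sumr -big_split /=; apply: eq_bigr => u _.
rewrite scaler_sumr -big_split /=; apply: eq_bigr => w _.
by rewrite mcoeffD mcoeffZ scalerA -scalerDl mulrDl mulrA.
Qed.

Lemma bilinC phi f g : bilin phi f g = bilin (fun u w => phi w u) g f.
Proof.
rewrite bilin.unlock exchange_big /=; apply: eq_bigr => u _.
by apply: eq_bigr => w _; rewrite mulrC.
Qed.

Lemma bilinPr phi c f g1 g2 :
  bilin phi f (c *: g1 + g2) = c *: bilin phi f g1 + bilin phi f g2.
Proof.
by rewrite (bilinC phi f g1) (bilinC phi f g2) (bilinC phi f (_ + _)) bilinPl.
Qed.

Lemma bilinUU (phi : seq A -> seq A -> V) u w :
  bilin phi << u >> << w >> = phi u w.
Proof.
by rewrite bilin.unlock !msuppU oner_eq0 !big_seq_fset1 !mcoeffUU mulr1 scale1r.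
Qed.

Lemma lin_ext (F G : V -> V) :
    (forall c f g, F (c *: f + g) = c *: F f + F g) ->
    (forall c f g, G (c *: f + g) = c *: G f + G g) ->
  (forall u, F << u >> = G << u >>) -> F =1 G.
Proof.
move=> linF linG eqFG f.
have F0 : F 0 = 0.
  by have := linF (-1) 0 0; rewrite scaler0 add0r scaleN1r addNr.
have G0 : G 0 = 0.
  by have := linG (-1) 0 0; rewrite scaler0 add0r scaleN1r addNr.
rewrite [f]monalgE; elim: (enum_fset _) => [|u s IH].
  by rewrite big_nil F0 G0.
have -> : \sum_(k <- u :: s) << f@_k *g k >>
        = f@_u *: << u >> + \sum_(k <- s) << f@_k *g k >> :> V.
  rewrite big_cons; congr (_ + _).
  by apply/malgP => k; rewrite mcoeffZ !mcoeffU mulr_natr.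
by rewrite linF linG eqFG IH.
Qed.

Local Notation "a ## f" := (concat << [:: a] >> f) (at level 40).
Local Notation "f \< g" := (half_shuffle f g) (at level 40).
Local Notation "f # g" := (shuffle f g) (at level 40).
Local Notation e := (<< ([::] : seq A) >> : V).

Lemma half_shuffle_nil w : e \< << w >> = 0.
Proof. by rewrite /half_shuffle bilinUU /half_shuffle_word; case: w. Qed.

Lemma half_shuffle_nilr u : u != [::] -> << u >> \< e = << u >>.
Proof. by rewrite /half_shuffle bilinUU; case: u => [//|a [|b u]]. Qed.

Lemma half_shuffle_letter a w : << [:: a] >> \< << w >> = << a :: w >>.
Proof. by rewrite /half_shuffle bilinUU; case: w. Qed.

Lemma concat_letter a u : a ## << u >> = << a :: u >>.
Proof. exact: bilinUU. Qed.

Lemma half_shuffle_recS n a b d u w :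
  half_shuffle_rec n.+1 (a :: b :: u) (d :: w)
  = a ## (half_shuffle_rec n (b :: u) (d :: w)
          + half_shuffle_rec n (d :: w) (b :: u)).
Proof. by []. Qed.

Lemma half_shuffle_cons a u w : u != [::] ->
  << a :: u >> \< << w >> = a ## (<< u >> \< << w >> + << w >> \< << u >>).
Proof.
case: u => [//|b u] _; case: w => [|d w].
  by rewrite half_shuffle_nil addr0 !half_shuffle_nilr // concat_letter.
rewrite /half_shuffle !bilinUU /half_shuffle_word.
rewrite [size (a :: _)]/= addSn half_shuffle_recS.
by rewrite [(size (d :: w) + _)%N]addnC.
Qed.

Lemma half_shufflePl c f1 f2 g :
  (c *: f1 + f2) \< g = c *: (f1 \< g) + f2 \< g.
Proof. exact: bilinPl. Qed.

Lemma half_shufflePr c f g1 g2 :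
  f \< (c *: g1 + g2) = c *: (f \< g1) + f \< g2.
Proof. exact: bilinPr. Qed.

Lemma concatPr c f g1 g2 :
  concat f (c *: g1 + g2) = c *: concat f g1 + concat f g2.
Proof. exact: bilinPr. Qed.

Lemma shuffleC f g : f # g = g # f.
Proof. by rewrite /shuffle [g@__ * _]mulrC [g \< f + _]addrC. Qed.

Lemma shufflePl c f1 f2 g : (c *: f1 + f2) # g = c *: (f1 # g) + f2 # g.
Proof.
rewrite /shuffle half_shufflePl half_shufflePr mcoeffD mcoeffZ.
have -> : << (c * f1@_([::] : seq A) + f2@_([::] : seq A)) * g@_([::] : seq A)
             *g ([::] : seq A) >>
  = c *: << f1@_([::] : seq A) * g@_([::] : seq A) *g ([::] : seq A) >>
    + << f2@_([::] : seq A) * g@_([::] : seq A) *g ([::] : seq A) >> :> V.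
  by apply/malgP => k; rewrite mcoeffD mcoeffZ !mcoeffU mulrDl mulrnDl mulrnAr mulrA.
by rewrite !scalerDr [RHS]addrACA; congr (_ + _); rewrite addrACA.
Qed.

Lemma shufflePr c f g1 g2 : f # (c *: g1 + g2) = c *: (f # g1) + f # g2.
Proof. by rewrite !(shuffleC f) shufflePl. Qed.

Lemma shuffle_wordE u w : u != [::] ->
  << u >> # << w >> = << u >> \< << w >> + << w >> \< << u >>.
Proof.
move=> nu; rewrite /shuffle [<< u >>@__]mcoeffU (negbTE nu) mul0r.
have -> : << 0 *g ([::] : seq A) >> = 0 :> V.
  by apply/malgP => k; rewrite mcoeffU mul0rn mcoeff0.
by rewrite addr0.
Qed.

Lemma shuffle_nil w : e # << w >> = << w >>.
Proof.
have [->|nw] := eqVneq w [::].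
  rewrite /shuffle half_shuffle_nil !add0r mcoeffUU mulr1.
  by apply/malgP => k; rewrite !mcoeffU.
by rewrite shuffleC shuffle_wordE // half_shuffle_nil half_shuffle_nilr // addr0.
Qed.

Lemma shuffle1g f : e # f = f.
Proof.
apply: (lin_ext (F := shuffle e) (G := id)) => //.
- by move=> c f1 f2; exact: shufflePr.
- exact: shuffle_nil.
Qed.

Lemma half_shuffle_concat a f g : (a ## f) \< g = a ## (f # g).
Proof.
move: f; apply: (lin_ext (F := fun f => (a ## f) \< g)
                         (G := fun f => a ## (f # g))).
- by move=> c f1 f2; rewrite concatPr half_shufflePl.
- by move=> c f1 f2; rewrite shufflePl concatPr.
move=> u; move: g; apply: (lin_ext (F := fun g => (a ## << u >>) \< g)
                         (G := fun g => a ## (<< u >> # g))).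
- by move=> c g1 g2; exact: half_shufflePr.
- by move=> c g1 g2; rewrite shufflePr concatPr.
move=> w; rewrite concat_letter; have [->|nu] := eqVneq u [::].
  by rewrite half_shuffle_letter shuffle_nil concat_letter.
by rewrite half_shuffle_cons // shuffle_wordE.
Qed.

Lemma mcoeff_concat0 a f : (a ## f)@_([::] : seq A) = 0.
Proof.
rewrite /concat bilin.unlock msuppU oner_eq0 big_seq_fset1 raddf_sum big1 //= => w _.
by rewrite mcoeffZ [X in _ * X]mcoeffU mulr0.
Qed.

Lemma shuffle_cons a b f g :
  (a ## f) # (b ## g) = a ## (f # (b ## g)) + b ## ((a ## f) # g).
Proof.
rewrite {1}/shuffle mcoeff_concat0 mul0r !half_shuffle_concat.
have -> : << 0 *g ([::] : seq A) >> = 0 :> V.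
  by apply/malgP => k; rewrite mcoeffU mul0rn mcoeff0.
by rewrite addr0 (shuffleC g).
Qed.

Lemma shuffleDl f g h : (f + g) # h = f # h + g # h.
Proof. by have := shufflePl 1 f g h; rewrite !scale1r. Qed.

Lemma shuffleDr f g h : f # (g + h) = f # g + f # h.
Proof. by rewrite !(shuffleC f) shuffleDl. Qed.

Lemma concatD a f g : a ## (f + g) = a ## f + a ## g.
Proof. by have := concatPr 1 << [:: a] >> f g; rewrite !scale1r. Qed.

(* Stated for abstract operations: matching on concrete sums in [V] is slow. *)
Lemma shuffleA_step (U : zmodType) (S : U -> U -> U) (L : A -> U -> U)
    (SC : commutative S) (SD : forall x y z, S x (y + z) = S x y + S x z)
    (LD : forall a x y, L a (x + y) = L a x + L a y)
    (SL : forall a b x y,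
       S (L a x) (L b y) = L a (S x (L b y)) + L b (S (L a x) y))
    (a b d : A) (x y z : U) :
    S x (S (L b y) (L d z)) = S (S x (L b y)) (L d z) ->
    S (L a x) (S y (L d z)) = S (S (L a x) y) (L d z) ->
    S (L a x) (S (L b y) z) = S (S (L a x) (L b y)) z ->
  S (L a x) (S (L b y) (L d z)) = S (S (L a x) (L b y)) (L d z).
Proof.
have S3 p q r (t1 t2 t3 : U) : S (L p t1) (S (L q t2) (L r t3))
    = L p (S t1 (S (L q t2) (L r t3))) + L q (S (L p t1) (S t2 (L r t3)))
      + L r (S (L p t1) (S (L q t2) t3)).
  by rewrite {1}(SL q) SD !(SL p) addrACA -LD -SD -(SL q) addrA.
move=> E1 E2 E3; rewrite (S3 a) E1 E2 E3 [RHS]SC (S3 d) -[RHS]addrA [RHS]addrC.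
by congr (L _ _ + L _ _ + L _ _); rewrite SC.
Qed.

Lemma shuffle_wordA u v w :
  << u >> # (<< v >> # << w >>) = (<< u >> # << v >>) # << w >>.
Proof.
have [n] := ubnP (size u + size v + size w).
elim: n u v w => [|n IH] u v w; first by move=> /notF [].
case: u => [|a u]; first by rewrite !shuffle1g.
case: v => [|b v].
  by rewrite [in LHS]shuffle1g (shuffleC << a :: u >> e) shuffle1g.
case: w => [|d w].
  by rewrite (shuffleC << b :: v >> e) shuffle1g [RHS]shuffleC shuffle1g.
rewrite /= !(addSn, addnS) ltnS => le_n.
have E1 := IH u (b :: v) (d :: w).
have E2 := IH (a :: u) v (d :: w).
have E3 := IH (a :: u) (b :: v) w.
move: E1 E2 E3; rewrite /= !(addSn, addnS) 
  -(concat_letter a u) -(concat_letter b v) -(concat_letter d w).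
move=> /(_ le_n) E1 /(_ le_n) E2 /(_ le_n) E3.
exact: (shuffleA_step (L := fun a f => a ## f) shuffleC shuffleDr concatD
                      shuffle_cons E1 E2 E3).
Qed.

Lemma shuffleA f g h : f # (g # h) = (f # g) # h.
Proof.
move: f; apply: (lin_ext (F := fun f => f # (g # h))
                         (G := fun f => (f # g) # h)) => [c f1 f2|c f1 f2|u].
- exact: shufflePl.
- by rewrite !shufflePl.
move: g; apply: (lin_ext (F := fun g => << u >> # (g # h))
                  (G := fun g => (<< u >> # g) # h)) => [c g1 g2|c g1 g2|v].
- by rewrite shufflePl shufflePr.
- by rewrite shufflePr shufflePl.
move: h; apply: (lin_ext (F := fun h => << u >> # (<< v >> # h))
            (G := fun h => (<< u >> # << v >>) # h)) => [c h1 h2|c h1 h2|w].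
- by rewrite !shufflePr.
- exact: shufflePr.
exact: shuffle_wordA.
Qed.

Lemma shuffle_unit_neq0 : e != 0.
Proof.
by apply/eqP => /malgP /(_ [::]) /eqP; rewrite mcoeffUU mcoeff0 oner_eq0.
Qed.

Lemma shuffleZl c f g : c *: (f # g) = (c *: f) # g.
Proof.
have := shufflePl c f 0 g; rewrite addr0 => ->.
have := shufflePl (-1) 0 0 g.
by rewrite scaler0 add0r scaleN1r addNr => ->; rewrite addr0.
Qed.

End HalfShuffle.

(* An alias of the space of words, carrying the shuffle product as [*%R]
   and the empty word as [1]. *)
Definition shuffle_alg (R : comNzRingType) (A : choiceType) : Type :=
  {malg R[seq A]}.

Section ShuffleAlgebra.
Variables (R : comNzRingType) (A : choiceType).

HB.instance Definition _ := GRing.Lmodule.on (shuffle_alg R A).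
HB.instance Definition _ := GRing.Zmodule_isComNzRing.Build (shuffle_alg R A)
  (@shuffleA R A) (@shuffleC R A) (@shuffle1g R A) (@shuffleDl R A)
  (@shuffle_unit_neq0 R A).
HB.instance Definition _ := GRing.Lmodule_isLalgebra.Build R (shuffle_alg R A)
  (@shuffleZl R A).
HB.instance Definition _ := GRing.Lalgebra_isComAlgebra.Build R (shuffle_alg R A).

End ShuffleAlgebra.

Inductive tree (A : Type) : Type := Leaf of A | Node of tree A & tree A.
Arguments Leaf {A}.
Arguments Node {A}.

Section TreeChoice.
Variable A : Type.

Fixpoint tree_encode (t : tree A) : GenTree.tree A :=
  match t with
  | Leaf a => GenTree.Leaf a
  | Node t1 t2 => GenTree.Node 0 [:: tree_encode t1; tree_encode t2]
  end.

Fixpoint tree_decode (t : GenTree.tree A) : option (tree A) :=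
  match t with
  | GenTree.Leaf a => Some (Leaf a)
  | GenTree.Node _ [:: t1; t2] =>
      if (tree_decode t1, tree_decode t2) is (Some u1, Some u2)
      then Some (Node u1 u2) else None
  | _ => None
  end.

Lemma tree_encodeK : pcancel tree_encode tree_decode.
Proof. by elim=> //= t1 -> t2 ->. Qed.

End TreeChoice.

HB.instance Definition _ (A : choiceType) :=
  Choice.copy (tree A) (pcan_type (@tree_encodeK A)).

(* The trees of degree at least 2 are exactly those of the form [Node _ _].
   [lt] matters only on members of [H]. *)
Record Hall_set (A : Type) (H : set (tree A)) (lt : tree A -> tree A -> Prop)
    : Prop := {
  Hall_lt_irr : forall t, H t -> ~ lt t t;
  Hall_lt_trans : forall s t u, H s -> H t -> H u ->
    lt s t -> lt t u -> lt s u;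
  Hall_lt_total : forall s t, H s -> H t -> [\/ lt s t, s = t | lt t s];
  Hall_lt_right : forall t' t'', H (Node t' t'') -> lt (Node t' t'') t'';
  Hall_letter : forall a, H (Leaf a);
  Hall_node : forall h1 h2, H (Node h1 h2) <->
    [/\ H h1, H h2, lt h1 h2 &
      match h1 with
      | Leaf _ => True
      | Node _ h1'' => lt h2 h1'' \/ h2 = h1''
      end]
}.

(* The map denoted by the half shuffle sign on trees; its values on a Hall set
   are the Hall integrals. *)
Fixpoint tree_integral (R : comNzRingType) (A : choiceType) (t : tree A)
    : shuffle_alg R A :=
  match t with
  | Leaf a => << [:: a] >>
  | Node t1 t2 => half_shuffle (tree_integral R t1) (tree_integral R t2)
  end.

(* Commutative polynomials in variables indexed by [I]: finitely supported
   functions on the commutative monomials [{cmonom I}]. *)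
Notation poly_in R I := {malg R[{cmonom I}]}.

Definition polyvar (R : comNzRingType) (I : choiceType) (i : I) : poly_in R I :=
  << ucm i >>.

Definition shuffle_eval (R : comNzRingType) (A : choiceType) (I : choiceType)
    (x : I -> shuffle_alg R A) (p : poly_in R I) : shuffle_alg R A :=
  \sum_(m <- msupp p) p@_m *: \prod_(i <- finsupp m) x i ^+ m i.

(* Main.v *)
(* A Hall tree is a left comb h = (((a, k1), ...), kn) with
   h < kn <= ... <= k1, and its integral is I_h = a (I_k1 ⧢ ... ⧢ I_kn).
   Deletion of a leading letter is a derivation of the shuffle product, so the
   leading-letter expansion of a product of Hall integrals is obtained by
   replacing one factor k by its letter followed by the product of its
   children.  A pair (letter, multiset of Hall trees) arises in this way from
   exactly one factor that dominates all the others.  Hence, with respect to the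
   maximal factor, the expansion is triangular, with multiplicities on the
   diagonal; these are invertible in characteristic 0, which gives both
   injectivity and surjectivity of the evaluation map. *)
Require Import Defs.
From HB Require Import structures.
From mathcomp Require Import all_boot all_order all_algebra.
From mathcomp Require Import finmap monalg.
From mathcomp Require Import boolp classical_sets reals.

Set Implicit Arguments.
Unset Strict Implicit.
Unset Printing Implicit Defensive.

Import GRing.Theory Num.Theory.
Local Open Scope ring_scope.

(** * Left deletion of letters *)

Lemma addr_linP (R : pzRingType) (U : lmodType R) (c : R) (x1 x2 y1 y2 : U) :
  c *: x1 + x2 + (c *: y1 + y2) = c *: (x1 + y1) + (x2 + y2).
Proof. by rewrite scalerDr addrACA. Qed.

Section Deletion.
Variables (R : comNzRingType) (A : choiceType).
Local Notation V := {malg R[seq A]}.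
Local Notation "a ## f" := (concat << [:: a] >> f) (at level 40).
Implicit Types (a b : A) (c : R) (f g : V).

(** The tails of all words of the support merely give a finite set outside which the coefficients
    [f@_(a :: u)] vanish. *)
Definition del a f : V :=
  [malg u in [fset behead w | w in msupp f]%fset => f@_(a :: u)].

Lemma mcoeff_del a f u : (del a f)@_u = f@_(a :: u).
Proof.
rewrite mcoeffE; case: ifPn => // /imfsetP H; rewrite mcoeff_outdom //.
by apply/negP => au; apply: H; exists (a :: u).
Qed.

Fact delP a : linear (del a).
Proof.
by move=> c f g; apply/malgP => u; rewrite !(mcoeff_del, mcoeffD, mcoeffZ).
Qed.

HB.instance Definition _ a :=
  GRing.isLinear.Build R V V *:%R (del a) (delP a).

Lemma del_word a b u : del a << b :: u >> = << u >> *+ (a == b).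
Proof.
apply/malgP => v; rewrite mcoeff_del mcoeffMn !mcoeffU -mulrnA eqseq_cons.
by rewrite mulnb andbC (eq_sym b).
Qed.

Lemma del_nil a : del a << [::] >> = 0.
Proof. by apply/malgP => v; rewrite mcoeff_del mcoeffU mcoeff0. Qed.

Lemma del_concat a b f : del a (b ## f) = f *+ (a == b).
Proof.
move: f; apply: (lin_ext (F := fun f => del a (b ## f))
                         (G := fun f => f *+ (a == b))).
- by move=> c f g; rewrite concatPr delP.
- by move=> c f g; rewrite mulrnDl scalerMnr.
by move=> u; rewrite concat_letter del_word.
Qed.

Lemma shuffle0 f : shuffle 0 f = 0.
Proof. exact: (@mul0r (shuffle_alg R A)). Qed.

(** By bilinearity it suffices to treat words: an empty one is the unit and is killed by [del a],
    and for two non-empty ones [shuffle_cons] displays both possible first letters. *)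
Lemma del_shuffle a f g :
  del a (shuffle f g) = shuffle (del a f) g + shuffle f (del a g).
Proof.
move: f; apply: (lin_ext (F := fun f => del a (shuffle f g))
   (G := fun f => shuffle (del a f) g + shuffle f (del a g))).
- by move=> c f1 f2; rewrite shufflePl delP.
- by move=> c f1 f2; rewrite delP !shufflePl addr_linP.
move=> u; move: g; apply: (lin_ext (F := fun g => del a (shuffle << u >> g))
   (G := fun g => shuffle (del a << u >>) g + shuffle << u >> (del a g))).
- by move=> c f1 f2; rewrite shufflePr delP.
- by move=> c f1 f2; rewrite delP !shufflePr addr_linP.
move=> w; case: u => [|b u]; first by rewrite !shuffle1g del_nil shuffle0 add0r.
case: w => [|d w].
  by rewrite del_nil ![shuffle _ << [::] >>]shuffleC !shuffle1g
             (shuffleC _ 0) shuffle0 addr0.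
rewrite -(concat_letter _ b u) -(concat_letter _ d w) shuffle_cons raddfD /=.
rewrite !del_concat !concat_letter.
case: (a == b); case: (a == d); rewrite ?mulr1n ?mulr0n ?shuffle0.
all: by rewrite ?(shuffleC _ 0) ?shuffle0.
Qed.

End Deletion.
Lemma del_decomp (R : comNzRingType) (A : finType) (f : {malg R[seq A]}) :
  f = f@_[::] *: << [::] >> + \sum_(a : A) concat << [:: a] >> (del a f).
Proof.
apply/malgP => -[|b u]; rewrite mcoeffD mcoeffZ raddf_sum.
  by rewrite mcoeffU eqxx mulr1 big1 ?addr0 // => a _; exact: mcoeff_concat0.
rewrite mcoeffU mulr0 add0r (bigD1 b) //= big1 => [|a /negbTE ab].
  by rewrite addr0 -[in RHS]mcoeff_del del_concat eqxx mcoeff_del.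
by rewrite -mcoeff_del del_concat eq_sym ab mcoeff0.
Qed.

(** * Hall trees *)

Section Trees.
Variable A : Type.
Implicit Types t : tree A.

Fixpoint letter t : A :=
  match t with Leaf a => a | Node t1 _ => letter t1 end.

(* A tree is a left comb [(((a, k1), ...), kn)]; these are the [ki]. *)
Fixpoint children t : seq (tree A) :=
  match t with Leaf _ => [::] | Node t1 t2 => rcons (children t1) t2 end.

Fixpoint leaves t : nat :=
  match t with Leaf _ => 1 | Node t1 t2 => (leaves t1 + leaves t2)%N end.

Lemma combE t : foldl Node (Leaf (letter t)) (children t) = t.
Proof. by elim: t => //= t1 IH t2 _; rewrite foldl_rcons IH. Qed.

Lemma leavesE t : leaves t = (\sum_(k <- children t) leaves k).+1%N.
Proof.
elim: t => [a|t1 IH t2 _] /=; first by rewrite big_nil.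
by rewrite IH -cats1 big_cat big_seq1 addSn.
Qed.

End Trees.

(** * Finite lists of trees, used for counting *)

Section TreesUpto.
Variable A : finType.

(** The recursion bounds the height, so trees with more than [n] leaves may occur too; what matters
    is that the list is finite and contains all those with at most [n]. *)
Fixpoint trees_upto n : seq (tree A) :=
  if n isn't n'.+1 then [::] else
  [seq Leaf a | a <- enum A] ++
  [seq Node s t | s <- trees_upto n', t <- trees_upto n'].

Lemma trees_uptoP n (t : tree A) : (leaves t <= n)%N -> t \in trees_upto n.
Proof.
have pos (s : tree A) : (0 < leaves s)%N by rewrite leavesE.
elim: n t => [|n IH] t; first by rewrite leqNgt pos.
case: t => [a|t1 t2] le_n /=; rewrite mem_cat; apply/orP; [left | right].
  by apply: map_f; rewrite mem_enum.
apply: (allpairs_f (@Node A)); apply: IH; rewrite -ltnS;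
  apply: leq_trans le_n => /=.
- by rewrite -addn1 leq_add2l pos.
- by rewrite -add1n leq_add2r pos.
Qed.

End TreesUpto.

(** * The order of a Hall set and the comb form of its trees *)

Section HallTrees.
Variables (A : choiceType) (H : set (tree A)) (lt : tree A -> tree A -> Prop).
Hypothesis hallH : Hall_set H lt.
Implicit Types (h k : H) (s X Y : seq H).

Definition lth h k : bool := `[< lt (val h) (val k) >].
Definition leh h k : bool := ~~ lth k h.

Let HP h : H (val h). Proof. exact: set_mem (valP h). Qed.
Let mkH t (Ht : H t) : H := exist _ t (mem_set Ht).

Lemma lth_irr h : lth h h = false.
Proof. by apply/asboolPn; exact: Hall_lt_irr hallH _ (HP h). Qed.

Lemma lth_trans : transitive lth.
Proof.
move=> k h l /asboolP hk /asboolP kl; apply/asboolP.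
exact: (Hall_lt_trans hallH) (HP h) (HP k) (HP l) hk kl.
Qed.

Lemma lehE h k : leh h k = (h == k) || lth h k.
Proof.
have [->|/eqP neq] := eqVneq h k; first by rewrite /leh lth_irr.
have asym x y : lth x y -> leh x y.
  by move=> xy; apply/negP => /(lth_trans xy); rewrite lth_irr.
have [hk|e|kh] := Hall_lt_total hallH (HP h) (HP k).
- have hk' : lth h k by exact/asboolP.
  by rewrite hk' asym.
- by case: neq; exact: val_inj.
- have kh' : lth k h by exact/asboolP.
  by rewrite /leh kh' (negbTE (asym _ _ kh')).
Qed.

Lemma lehh h : leh h h. Proof. by rewrite lehE eqxx. Qed.

Lemma lthW h k : lth h k -> leh h k.
Proof. by rewrite lehE => ->; rewrite orbT. Qed.

Lemma lehNgt h k : leh h k = ~~ lth k h. Proof. by []. Qed.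

Lemma lthNge h k : lth h k = ~~ leh k h. Proof. by rewrite negbK. Qed.

Lemma lth_le_trans k h l : lth h k -> leh k l -> lth h l.
Proof. by rewrite lehE => hk /orP[/eqP<-//|]; exact: lth_trans. Qed.

Lemma leh_trans : transitive leh.
Proof.
move=> k h l; rewrite lehE => /orP[/eqP->//|hk] /(lth_le_trans hk).
exact: lthW.
Qed.

Lemma leh_total : total leh.
Proof.
by move=> h k; rewrite -implyNb -lthNge; apply/implyP; exact: lthW.
Qed.

Lemma leh_anti : antisymmetric leh.
Proof.
move=> h k /andP[+ /negbTE kh].
by rewrite lehE kh orbF => /eqP.
Qed.

Lemma max_exists (i0 : H) s : i0 \in s ->
  exists2 h, h \in s & {in s, forall k, leh k h}.
Proof.
move=> s0; have : size s != 0%N by case: s s0.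
elim: s {s0} => // h [|k s] IH _.
  by exists h; rewrite ?mem_head // => k; rewrite inE => /eqP->; exact: lehh.
have [//|m ms mmax] := IH; have [hm|mh] := orP (leh_total h m).
  exists m; first by rewrite inE ms orbT.
  by move=> l; rewrite inE => /predU1P[->//|/mmax].
exists h; first by rewrite mem_head.
move=> l; rewrite inE => /predU1P[->|/mmax lm]; first exact: lehh.
exact: leh_trans lm mh.
Qed.

Definition hletter h : A := letter (val h).
(** [insub] discards nothing, because the children of a Hall tree are Hall trees; see
    [hchildrenE]. *)
Definition hchildren h : seq H := pmap insub (children (val h)).

Lemma hall_ind (P : H -> Prop) :
    (forall h a, val h = Leaf a -> P h) ->
    (forall h h1 h2, val h = Node (val h1) (val h2) -> P h1 -> P h) ->
  forall h, P h.
Proof.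
move=> Pleaf Pnode [t tH]; elim: t tH => [a|t1 IH t2 _] tH.
  exact: (Pleaf _ a).
have /(Hall_node hallH)[H1 H2 _ _] := set_mem tH.
exact: (Pnode _ (mkH H1) (mkH H2)) (IH _).
Qed.

Lemma hchildren_leaf h a : val h = Leaf a -> hchildren h = [::].
Proof. by rewrite /hchildren => ->. Qed.

Lemma hchildren_node h h1 h2 : val h = Node (val h1) (val h2) ->
  hchildren h = rcons (hchildren h1) h2.
Proof.
rewrite /hchildren => -> /=; rewrite -!cats1 pmap_cat /=.
by rewrite valK.
Qed.

Lemma hchildrenE h : map val (hchildren h) = children (val h).
Proof.
elim/hall_ind: h => [h a E|h h1 h2 E IH].
  by rewrite (hchildren_leaf E) E.
by rewrite (hchildren_node E) map_rcons IH E.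
Qed.

(** The Hall condition compares [h2] with the last child of [h1] only; induction along the left
    spine carries the bound to the earlier children, which are at least as large. *)
Lemma node_spec h h1 h2 : val h = Node (val h1) (val h2) ->
  [/\ lth h1 h2, all (leh h2) (hchildren h1) & lth h h2].
Proof.
elim/hall_ind: h1 h h2 => [h1 a E1|h1 g1 g2 E1 IH] h h2 E.
  have Hh := HP h; rewrite E in Hh.
  have [_ _ l12 _] := (Hall_node hallH _ _).1 Hh.
  split; [exact/asboolP | by rewrite (hchildren_leaf E1)|].
  by apply/asboolP; rewrite E; exact: Hall_lt_right hallH _ _ Hh.
have Hh := HP h; rewrite E in Hh.
have [_ _ l12 E12] := (Hall_node hallH _ _).1 Hh.
split; [exact/asboolP | |].
  2: by apply/asboolP; rewrite E; exact: Hall_lt_right hallH _ _ Hh.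
rewrite E1 in E12.
have h2g2 : leh h2 g2.
  rewrite lehE; case: E12 => [l|e]; last by rewrite (val_inj e) eqxx.
  by apply/orP; right; exact/asboolP.
rewrite (hchildren_node E1) all_rcons h2g2 /=.
have [_ ge_g2 _] := IH _ _ E1.
by apply: sub_all ge_g2 => x; exact: leh_trans.
Qed.

Lemma node_exists h1 h2 : lth h1 h2 -> all (leh h2) (hchildren h1) ->
  exists h, val h = Node (val h1) (val h2).
Proof.
move=> l12 ge2; suff Hh : H (Node (val h1) (val h2)) by exists (mkH Hh).
apply/(Hall_node hallH); split; [exact: HP | exact: HP | exact/asboolP |].
elim/hall_ind: h1 {l12} ge2 => [h1 a ->//|h1 g1 g2 E _].
rewrite (hchildren_node E) all_rcons E => /andP[+ _]; rewrite lehE.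
by case/orP => [/eqP->|/asboolP]; [right | left].
Qed.

Lemma hchildren_gt h : all (lth h) (hchildren h).
Proof.
elim/hall_ind: h => [h a E|h h1 h2 E _]; first by rewrite (hchildren_leaf E).
have [_ ge2 lt2] := node_spec E.
rewrite (hchildren_node E) all_rcons lt2 /=.
by apply: sub_all ge2 => x; exact: lth_le_trans.
Qed.

Lemma hchildren_sorted h : sorted (fun x y => leh y x) (hchildren h).
Proof.
have tr : transitive (fun x y => leh y x) by move=> x y z xy /leh_trans; exact.
rewrite (sorted_pairwise tr); elim/hall_ind: h => [h a E|h h1 h2 E IH].
  by rewrite (hchildren_leaf E).
have [_ ge2 _] := node_spec E.
by rewrite (hchildren_node E) pairwise_rcons IH ge2.
Qed.

Lemma hcomb_inj h k :
  hletter h = hletter k -> hchildren h = hchildren k -> h = k.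
Proof.
move=> ehk echk; apply: val_inj; rewrite -(combE (val h)) -(combE (val k)).
by rewrite -/(hletter h) ehk -!hchildrenE echk.
Qed.

(** Every initial segment of the comb [k] is a Hall tree; the segment that joins [y] to [h] yields
    the inequality. *)
Lemma hcomb_extend_lt h k y s : hletter h = hletter k ->
  hchildren k = hchildren h ++ y :: s -> lth h y.
Proof.
move=> ehk ck.
have : val k = foldl Node (Node (val h) (val y)) (map val s).
  rewrite -(combE (val k)) -hchildrenE ck -/(hletter k) -ehk map_cat foldl_cat.
  by rewrite /= hchildrenE /hletter combE.
move: (HP k) => /[swap] ->; set t := Node _ _ => Ht.
suff /(Hall_node hallH)[_ _ l _] : H t by exact/asboolP.
elim/last_ind: s Ht {ck} => //= s z IH; rewrite map_rcons foldl_rcons.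
by case/(Hall_node hallH) => /IH.
Qed.

(* The children of [h] are the elements above [h] on either side, so [k] extends
   the comb [h]; a further child [y] would satisfy both [h < y]
   and [y <= h]. *)
Lemma max_factor_unique h k X Y : hletter h = hletter k ->
    perm_eq (hchildren h ++ Y) (hchildren k ++ X) ->
    all (leh^~ h) Y -> all (leh^~ h) X ->
  h = k.
Proof.
move=> ehk pe leY leX.
have gtF Z : all (leh^~ h) Z -> filter (lth h) Z = [::].
  move=> leZ; apply/eqP; rewrite -[_ == _]negbK -has_filter -all_predC.
  by apply: sub_all leZ.
have tr : transitive (fun x y => leh y x) by move=> x y z xy /leh_trans; exact.
have anti : antisymmetric (fun x y => leh y x).
  by move=> x y /andP[yx xy]; apply: leh_anti; rewrite xy.
have ech : hchildren h = filter (lth h) (hchildren k).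
  apply: (sorted_eq tr anti) (hchildren_sorted _) _ _.
    exact: sorted_filter (hchildren_sorted _).
  have /perm_filter := pe => /(_ (lth h)).
  rewrite !filter_cat (gtF _ leY) (gtF _ leX) !cats0.
  by rewrite (all_filterP (hchildren_gt h)).
(* The children of [k] decrease weakly, so those above [h] form an initial segment. *)
have split_k : hchildren k =
    filter (lth h) (hchildren k) ++ filter (leh^~ h) (hchildren k).
  apply: (sorted_eq tr anti) (hchildren_sorted _) _ _; last first.
    by rewrite perm_sym (permEl (perm_filterC (lth h) _)).
  rewrite (sorted_pairwise tr) pairwise_cat -!(sorted_pairwise tr).
  rewrite !(sorted_filter tr) ?hchildren_sorted // !andbT.
  apply/allrelP => x y; rewrite !mem_filter => /andP[hx _] /andP[yh _].
  exact: leh_trans yh (lthW hx).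
rewrite -ech in split_k.
case E : (filter (leh^~ h) (hchildren k)) split_k => [|y s] split_k.
  by apply: hcomb_inj; rewrite // split_k cats0.
have : leh y h.
  have : y \in filter (leh^~ h) (hchildren k) by rewrite E mem_head.
  by rewrite mem_filter => /andP[].
by rewrite lehNgt (hcomb_extend_lt ehk split_k).
Qed.

(** Greedy construction: sort [s] decreasingly, start from the letter [a], and attach the next
    element as a child as long as it exceeds the tree built so far. At the first failure that tree
    dominates all that remains. *)
Lemma max_factor_exists (a : A) s : exists h Y,
  [/\ hletter h = a, perm_eq (hchildren h ++ Y) s & all (leh^~ h) Y].
Proof.
pose geh x y := leh y x.
have tr : transitive geh by move=> x y z xy /leh_trans; exact.
pose r := sort geh s.
have r_sorted : sorted geh r by apply: sort_sorted => x y; exact: leh_total.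
have pr : perm_eq r s by rewrite perm_sort.
suff grow h Y : hletter h = a -> hchildren h ++ Y = r -> exists h Y,
    [/\ hletter h = a, perm_eq (hchildren h ++ Y) s & all (leh^~ h) Y].
  exact: (grow (mkH (Hall_letter hallH a)) r).
elim: Y h => [|y Y IH] h ha Er.
  by exists h, [::]; split=> //; rewrite Er.
have := r_sorted; rewrite -Er (sorted_pairwise tr) pairwise_cat.
case/and3P=> /allrelP hY _ /= /andP[yY _].
have [hy|] := boolP (lth h y); last first.
  rewrite -lehNgt => yh; exists h, (y :: Y); rewrite Er; split=> //=.
  by rewrite yh; apply: sub_all yY => x xy; exact: leh_trans xy yh.
have [|k Ek] := node_exists hy.
  by apply/allP => x xh; apply: hY; rewrite ?mem_head.
apply: (IH k); last by rewrite (hchildren_node Ek) cat_rcons.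
by rewrite -ha /hletter Ek.
Qed.

Lemma hleavesE h :
  leaves (val h) = (\sum_(k <- hchildren h) leaves (val k)).+1%N.
Proof. by rewrite leavesE -hchildrenE big_map. Qed.

End HallTrees.

(** * Evaluation of shuffle polynomials *)

Section Monomials.
Variable I : choiceType.
Implicit Types (s t : seq I) (m : {cmonom I}).

Definition mon s : {cmonom I} := \big[mmul/mone]_(i <- s) ucm i.

Definition mon_seq m : seq I := flatten [seq nseq (m i) i | i <- finsupp m].

Lemma monE s i : mon s i = count_mem i s.
Proof.
elim: s => [|j s IH]; rewrite /mon ?big_nil ?cm1 // big_cons cmM cmU.
by rewrite [X in (_ + X)%N]IH.
Qed.

Lemma mon_seqK : cancel mon_seq mon.
Proof.
move=> m; apply/eqP/cmP => i.
rewrite monE count_flatten -map_comp sumnE big_map.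
rewrite (eq_bigr (fun j => (j == i) * m j)%N) => [|j _]; last first.
  by rewrite /= count_nseq.
case: mdomP => [mi|mi].
  rewrite (bigD1_seq i) //= eqxx mul1n big1 ?addn0 // => j /negbTE->.
  by rewrite mul0n.
rewrite big1_seq // => j /= mj; case: eqP => [E|]; last by rewrite mul0n.
by rewrite -E mj in mi.
Qed.

Lemma mon_eq s t : (mon s == mon t) = perm_eq s t.
Proof.
apply/cmP/permP => [E|E i]; last by rewrite !monE.
by apply/permP/allP => i _; rewrite /= -!monE E.
Qed.

Lemma mon_seq_mon s : perm_eq (mon_seq (mon s)) s.
Proof. by rewrite -mon_eq mon_seqK. Qed.

End Monomials.

Section Evaluation.
Variables (R : comNzRingType) (A I : choiceType) (x : I -> shuffle_alg R A).
Implicit Types (p q : poly_in R I) (m : {cmonom I}) (s : seq I).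

Definition mon_eval m : shuffle_alg R A := \prod_(i <- finsupp m) x i ^+ m i.

Lemma mon_eval_seq m : mon_eval m = \prod_(i <- mon_seq m) x i.
Proof.
rewrite /mon_eval /mon_seq big_flatten big_map.
by apply: eq_bigr => i _; rewrite big_nseq iter_mulr_1.
Qed.

Lemma mon_eval_mon s : mon_eval (mon s) = \prod_(i <- s) x i.
Proof. by rewrite mon_eval_seq; exact: perm_big (mon_seq_mon s). Qed.

Fact mon_eval_mmorphism : mmorphism mon_eval.
Proof.
split=> [m1 m2|]; last first.
  by have := mon_eval_mon [::]; rewrite /mon !big_nil.
rewrite !mon_eval_seq -big_cat; apply: perm_big.
rewrite -mon_eq mon_seqK /mon big_cat -/(mon _) -/(mon _).
by rewrite !mon_seqK.
Qed.

HB.instance Definition _ :=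
  isMultiplicative.Build {cmonom I} (shuffle_alg R A) mon_eval
    mon_eval_mmorphism.

Lemma shuffle_evalE : shuffle_eval x = mmap (in_alg (shuffle_alg R A)) mon_eval.
Proof.
apply/funext => p; apply: eq_bigr => m _.
by rewrite /= mulr_algl.
Qed.

Fact shuffle_eval_zmod_morphism : zmod_morphism (shuffle_eval x).
Proof. by rewrite shuffle_evalE; exact: raddfB. Qed.

Fact shuffle_eval_monoid_morphism : monoid_morphism (shuffle_eval x).
Proof.
by rewrite shuffle_evalE; split; [exact: rmorph1 | exact: rmorphM].
Qed.

Fact shuffle_eval_scalable : scalable (shuffle_eval x).
Proof. by move=> c p; rewrite shuffle_evalE mmapZ /= mulr_algl. Qed.

HB.instance Definition _ :=
  GRing.isZmodMorphism.Build (poly_in R I) (shuffle_alg R A) (shuffle_eval x)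
    shuffle_eval_zmod_morphism.
HB.instance Definition _ :=
  GRing.isMonoidMorphism.Build (poly_in R I) (shuffle_alg R A) (shuffle_eval x)
    shuffle_eval_monoid_morphism.
HB.instance Definition _ :=
  GRing.isScalable.Build R (poly_in R I) (shuffle_alg R A) *:%R (shuffle_eval x)
    shuffle_eval_scalable.

Lemma shuffle_eval_mon m : shuffle_eval x << m >> = mon_eval m.
Proof. by rewrite shuffle_evalE mmapU /= scale1r mul1r. Qed.

Lemma shuffle_eval_var i : shuffle_eval x (polyvar R i) = x i.
Proof.
have := mon_eval_mon [:: i]; rewrite /mon !big_seq1 => <-.
exact: shuffle_eval_mon.
Qed.

End Evaluation.

Section Concat.
Variables (R : comNzRingType) (A : choiceType).
Local Notation V := {malg R[seq A]}.

Fact concat_linear (f : V) : linear (concat f).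
Proof. by move=> c g1 g2; exact: concatPr. Qed.

HB.instance Definition _ (f : V) :=
  GRing.isLinear.Build R V V *:%R (concat f) (concat_linear f).

(** By [half_shuffle_concat], half shuffling a word sum with leading letter [a] by [g] multiplies
    what follows [a] by [g], so each child along the left spine becomes one more factor. *)
Lemma tree_integral_comb (t : tree A) :
  tree_integral R t = concat << [:: letter t] >>
    (\prod_(k <- children t) tree_integral R k : shuffle_alg R A).
Proof.
elim: t => [a|t1 IH t2 _] /=; first by rewrite big_nil concat_letter.
rewrite IH half_shuffle_concat -cats1 big_cat big_seq1.
by [].
Qed.

End Concat.

(** * Triangularity *)

Lemma scaler_solve (F : fieldType) (L : lmodType F) (c : F) (f e u v : L) :
  c != 0 -> f = e + (c *: u + v) -> u = c^-1 *: (f + (- e - v)).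
Proof.
move=> c0 ->; rewrite addrACA subrr add0r addrK scalerA mulVf //.
by rewrite scale1r.
Qed.

Section HallBasis.
Variables (R : numFieldType) (A : finType) (H : set (tree A)).
Variables (lt : tree A -> tree A -> Prop) (hallH : Hall_set H lt).
Implicit Types (h k : H) (s X Y : seq H) (a b : A) (p : poly_in R H).

Let x h : shuffle_alg R A := tree_integral R (\val h).
Local Notation P s := (\prod_(i <- s) x i).
Local Notation E := (shuffle_eval x).
Local Notation mul_letter a f := (concat << [:: a] >> f).

Lemma hintegralE h : x h = mul_letter (hletter h) (P (hchildren h)).
Proof.
by rewrite /x tree_integral_comb -(hchildrenE hallH) big_map.
Qed.

(** Leibniz rule: a factor [k] with letter [a] becomes the product of its children, any other
    becomes zero. The sum runs over occurrences, so multiplicities are kept. *)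
Lemma del_prod a s : del a (P s) =
  \sum_(k <- s | hletter k == a) P (hchildren k ++ rem k s).
Proof.
elim: s => [|j s IH]; first by rewrite !big_nil del_nil.
rewrite !big_cons del_shuffle IH [in del a (x j)]hintegralE del_concat.
have -> : shuffle (x j)
    (\sum_(k <- s | hletter k == a) P (hchildren k ++ rem k s)) =
    \sum_(k <- s | hletter k == a) P (hchildren k ++ rem k (j :: s)).
  rewrite -[shuffle _ _]/(x j * _) mulr_sumr.
  rewrite [LHS]big_seq_cond [RHS]big_seq_cond.
  apply: eq_bigr => k /andP[ks _].
  transitivity (P (j :: hchildren k ++ rem k s)); first by rewrite big_cons.
  rewrite (perm_big (hchildren k ++ rem k (j::s))) //.
  rewrite -cat1s perm_catCA perm_cat2l /=.
  (* If [k = j], [rem] removes the head instead of an occurrence in [s]; the multiset is the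
     same. *)
  by case: eqVneq => // ->; rewrite perm_sym perm_to_rem.
rewrite /= eqxx (eq_sym a); case: (hletter j == a).
  by rewrite mulr1n big_cat.
by rewrite mulr0n shuffle0 add0r.
Qed.


(** The common length of the words occurring in [P s]. *)
Definition wt s : nat := (\sum_(k <- s) leaves (val k))%N.

Lemma perm_wt s Y : perm_eq s Y -> wt s = wt Y.
Proof. by move=> sY; exact: perm_big. Qed.

Lemma wt_cat s Y : wt (s ++ Y) = (wt s + wt Y)%N.
Proof. exact: big_cat. Qed.

Lemma wt_cons h s : wt (h :: s) = (wt (hchildren h ++ s)).+1.
Proof. by rewrite wt_cat /wt big_cons (hleavesE hallH h). Qed.

Lemma wt_rem k s : k \in s -> wt s = (wt (hchildren k ++ rem k s)).+1.
Proof. by move=> ks; rewrite -wt_cons; exact/perm_wt/perm_to_rem. Qed.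

Definition in_image (f : shuffle_alg R A) := exists p, E p = f.

Lemma in_imageD f g : in_image f -> in_image g -> in_image (f + g).
Proof. by move=> [p <-] [q <-]; exists (p + q); rewrite raddfD. Qed.

Lemma in_imageZ c f : in_image f -> in_image (c *: f).
Proof. by move=> [p <-]; exists (c *: p); rewrite linearZ. Qed.

Lemma in_image_sum (J : eqType) (r : seq J) (Q : pred J) F :
    (forall j, j \in r -> Q j -> in_image (F j)) ->
  in_image (\sum_(j <- r | Q j) F j).
Proof.
move=> im; rewrite big_seq_cond.
apply: (big_ind in_image) => [||j /andP[]]; last exact: im.
  by exists 0; rewrite raddf0.
exact: in_imageD.
Qed.

Lemma in_image_prod s : in_image (P s).
Proof. by exists << mon s >>; rewrite shuffle_eval_mon mon_eval_mon. Qed.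

Lemma count_lt (T : eqType) (p q : pred T) (l : seq T) (y : T) :
    (forall z, p z -> q z) -> y \in l -> q y -> ~~ p y ->
  (count p l < count q l)%N.
Proof.
move=> pq + qy py; elim: l => //= z l IH; rewrite inE => /predU1P[<-|/IH lt_l].
  by rewrite qy (negbTE py) ltnS; exact: sub_count.
rewrite -addnS leq_add //; have := pq z.
by case: (p z) => // ->.
Qed.

(** A rank for induction along [lt], which may have infinite descending chains; within bounded
    degree only finitely many trees compete. *)
Definition below n h : nat :=
  count (fun t => `[< H t /\ lt t (val h) >]) (trees_upto A n).

(** Transitivity gives the inclusion of the counted trees; it is strict because [h] is listed and
    counted for [k] only. *)
Lemma below_lt n h k : (leaves (val h) <= n)%N -> lth lt h k ->
  (below n h < below n k)%N.
Proof.
move=> le_n hk; pose u (l : H) t := `[< H t /\ lt t (val l) >].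
have Hv (l : H) : H (val l) by exact: set_mem (valP l).
have uhk t : u h t -> u k t.
  move=> /asboolP[Ht th]; apply/asboolP; split=> //.
  exact: (Hall_lt_trans hallH) Ht (Hv h) (Hv k) th (asboolW hk).
apply: (count_lt uhk (trees_uptoP le_n)).
  by apply/asboolP; split; [exact: Hv | exact/asboolP].
by apply/asboolPn => -[_]; exact: Hall_lt_irr hallH _ (Hv h).
Qed.

(* By [max_factor_unique], in [P (h :: Y) = \sum_b b . del b (P (h :: Y))] the
   terms other than multiples of [a . P s] have a smaller maximal factor. *)
Lemma in_image_mul_letter a s : in_image (mul_letter a (P s)).
Proof.
have [h [Y [ha pe leY]]] := max_factor_exists hallH a s.
(* This weight stays constant throughout the induction, so a single list of trees serves to compare
   all the ranks. *)
set n := (wt s).+1; have : wt (h :: Y) = n by rewrite wt_cons (perm_wt pe).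
have [m] := ubnP (below n h).
elim: m h Y a s {n}(n) ha pe leY => // m IH h Y a s n ha pe leY hm wn.
set f := P (h :: Y); pose c := count_mem h (h :: Y).
pose T k : shuffle_alg R A :=
  mul_letter (hletter k) (P (hchildren k ++ rem k (h :: Y))).
have Ef : f = f@_[::] *: 1 + \sum_(k <- h :: Y) T k.
  rewrite {1}[f]del_decomp; congr (_ + _).
  under eq_bigr => b _ do rewrite del_prod linear_sum.
  rewrite (exchange_big_dep predT) //=; apply: eq_bigr => k _.
  by rewrite (big_pred1 (hletter k)) // => b; rewrite /= eq_sym.
have Th : T h = mul_letter a (P s).
  by rewrite /T ha /= eqxx (perm_big s pe).
have Ec : \sum_(k <- h :: Y) T k =
    c%:R *: mul_letter a (P s) + \sum_(k <- h :: Y | k != h) T k.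
  rewrite (bigID (pred1 h)) /=; congr (_ + _).
  rewrite (eq_bigr (fun=> T h)) => [|k /eqP-> //].
  by rewrite big_const_seq iter_addr_0 Th scaler_nat.
(* The head makes the multiplicity of [h] positive, hence invertible in characteristic 0. *)
have c0 : c%:R != 0 :> R by rewrite pnatr_eq0 /c /= eqxx.
have -> : mul_letter a (P s) = c%:R^-1 *: (f + (- f@_[::] *: 1 +
    (-1) *: \sum_(k <- h :: Y | k != h) T k)).
  by rewrite scaleNr scaleN1r; apply: scaler_solve; rewrite -?Ec.
apply/in_imageZ/in_imageD; first exact: in_image_prod.
apply: in_imageD; apply: in_imageZ.
  by exists 1; rewrite rmorph1.
apply: in_image_sum => k kY kh.
have [h' [Y' [ha' pe' leY']]] :=
  max_factor_exists hallH (hletter k) (hchildren k ++ rem k (h :: Y)).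
have wn' : wt (h' :: Y') = n by rewrite -wn wt_cons (perm_wt pe') -wt_rem.
apply: (IH h' Y' _ _ n) => //.
rewrite -ltnS; apply: leq_trans hm; rewrite ltnS.
apply: below_lt.
  by rewrite -wn' /wt big_cons leq_addr.
(* If [h] were at most [h'], both remainders would be bounded by [h'], so uniqueness would give
   [h' = k]; as [k] is at most [h], this would force [k = h]. *)
rewrite lthNge; apply/negP => hh'.
have leX : all (leh lt^~ h') (rem k (h :: Y)).
  apply/allP => l /mem_rem; rewrite inE => /predU1P[->//|lY].
  exact: (leh_trans hallH) (allP leY _ lY) hh'.
have eq_k := max_factor_unique hallH ha' pe' leY' leX.
have : leh lt k h by apply: (allP leY); move: kY; rewrite inE (negbTE kh).
move: hh'; rewrite eq_k => hk kh'; move/eqP: kh; apply.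
by apply: (leh_anti hallH); rewrite kh' hk.
Qed.

(** Words are reached by induction: a preimage of [u] writes it as a combination of products of Hall
    integrals, and [in_image_mul_letter] lets a letter be prefixed to each product. *)
Lemma shuffle_eval_surj f : in_image f.
Proof.
have im_word u : in_image << u >>.
  elim: u => [|a u [p Ep]]; first by exists 1; rewrite rmorph1.
  rewrite -concat_letter -Ep /shuffle_eval.
  have -> : mul_letter a (\sum_(m <- msupp p) p@_m *: mon_eval x m) =
      \sum_(m <- msupp p)
        p@_m *: (mul_letter a (P (mon_seq m)) : shuffle_alg R A).
    rewrite linear_sum; apply: eq_bigr => m _.
    by rewrite linearZ mon_eval_seq.
  by apply: in_image_sum => m _ _; apply: in_imageZ; exact: in_image_mul_letter.
have -> : f = \sum_(u <- msupp f) f@_u *: (<< u >> : shuffle_alg R A).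
  rewrite [LHS]monalgE; apply: eq_bigr => u _.
  by apply/malgP => v; rewrite mcoeffZ !mcoeffU mulr_natr.
by apply: in_image_sum => u _ _; apply: in_imageZ.
Qed.

(* The derivation of the polynomial ring that [E] intertwines with [del a]. *)
Definition poly_del a p : poly_in R H :=
  \sum_(m <- msupp p) p@_m *:
    \sum_(k <- mon_seq m | hletter k == a)
      << mon (hchildren k ++ rem k (mon_seq m)) >>.

Lemma shuffle_eval_poly_del a p : E (poly_del a p) = del a (E p).
Proof.
rewrite /poly_del [in RHS]/shuffle_eval !linear_sum; apply: eq_bigr => m _.
rewrite [LHS]linearZ [RHS]linearZ /= -/(mon_eval x m) mon_eval_seq del_prod.
set S := E _; have -> : S =
    \sum_(k <- mon_seq m | hletter k == a) P (hchildren k ++ rem k (mon_seq m)).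
  rewrite /S (raddf_sum (shuffle_eval x)) /=; apply: eq_bigr => k _.
  by rewrite shuffle_eval_mon mon_eval_mon.
by [].
Qed.

Lemma mcoeff_poly_del a p m' : (poly_del a p)@_m' =
  \sum_(m <- msupp p) p@_m *
    \sum_(k <- mon_seq m | hletter k == a)
      (mon (hchildren k ++ rem k (mon_seq m)) == m')%:R.
Proof.
rewrite raddf_sum; apply: eq_bigr => m _; rewrite /= mcoeffZ raddf_sum.
by congr (_ * _); apply: eq_bigr => k _; rewrite /= mcoeffU.
Qed.

(** Induction on a strict bound for the weights of the monomials. Each [poly_del a] lowers weights
    by one, so all these derivatives vanish; a non-constant [p] contradicts this at a monomial
    containing its greatest variable. *)
Lemma shuffle_eval_eq0 p : E p = 0 -> p = 0.
Proof.
suff main n : (forall m, m \in msupp p -> (wt (mon_seq m) < n)%N) ->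
    E p = 0 -> p = 0.
  apply: (main (\max_(m <- msupp p) (wt (mon_seq m)).+1)%N) => m mp.
  exact: (leq_bigmax_seq (F := fun m => (wt (mon_seq m)).+1) m).
elim: n p => [|n IH] p p_supp Ep.
  by apply/eqP; rewrite -msupp_eq0; apply/eqP/fsetP => m; rewrite inE;
     apply/negP => /p_supp.
have del0 a : poly_del a p = 0.
  apply: IH; last by rewrite shuffle_eval_poly_del Ep linear0.
  move=> m'; rewrite -mcoeff_neq0; apply: contraR; rewrite -leqNgt => le_n.
  rewrite mcoeff_poly_del big1_seq // => m /= mp.
  rewrite big1_seq ?mulr0 // => k /andP[_ km].
  case: eqP => // Em'; have := p_supp _ mp.
  by rewrite (wt_rem km) ltnS -(perm_wt (mon_seq_mon _)) Em' ltnNge le_n.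
(* If no variable occurs, [p] is a constant, and evaluation is injective on constants. *)
case EL : (flatten [seq mon_seq m | m <- msupp p]) => [|h0 L].
  have p1 : p = p@_mone *: 1.
    apply/malgP => m; rewrite mcoeffZ mcoeff1.
    have [->|m1] := eqVneq m mone; first by rewrite mulr1.
    rewrite mulr0; apply: mcoeff_outdom; apply: contra_neqN m1 => mp.
    rewrite -[m]mon_seqK; case Em : (mon_seq m) => [|k s].
      by rewrite /mon big_nil.
    have : k \in flatten [seq mon_seq m | m <- msupp p].
      by apply/flatten_mapP; exists m; rewrite // Em mem_head.
    by rewrite EL.
  move/eqP: Ep; rewrite p1 linearZ rmorph1 scaler_eq0 oner_eq0 orbF => /eqP->.
  by rewrite scale0r.
have [h + hmax] := max_exists hallH (mem_head h0 L).
rewrite -EL => /flatten_mapP[m mp hm].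
have le_h m' : m' \in msupp p -> {in mon_seq m', forall k, leh lt k h}.
  by move=> mp' k km; apply: hmax; rewrite -EL; apply/flatten_mapP; exists m'.
set t := hchildren h ++ rem h (mon_seq m).
(* Since [h] bounds every variable of [p], a factor [k] of [m'] producing the multiset [t] must be
   [h] by uniqueness; cancelling the children then gives [m' = m]. *)
have rest : \sum_(m' <- msupp p | m' != m) p@_m' *
    \sum_(k <- mon_seq m' | hletter k == hletter h)
      (mon (hchildren k ++ rem k (mon_seq m')) == mon t)%:R = 0.
  apply: big1_seq => m' /andP[neq mp'].
  rewrite big1_seq ?mulr0 // => k /andP[/eqP ek km].
  case: eqP => // /eqP; rewrite mon_eq perm_sym => pe.
  have hk : h = k.
    apply: (max_factor_unique hallH (esym ek) pe).
      by apply/allP => l /mem_rem; exact: le_h.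
    by apply/allP => l /mem_rem; exact: le_h.
  move: pe km; rewrite /t -hk perm_cat2l => pe km.
  case/eqP: neq; rewrite -[m]mon_seqK -[m']mon_seqK; apply/eqP.
  rewrite mon_eq (permPl (perm_to_rem km)) perm_sym (permPl (perm_to_rem hm)).
  by rewrite perm_cons.
have := mcoeff_poly_del (hletter h) p (mon t).
rewrite del0 mcoeff0 (bigD1_seq m) ?fset_uniq //= rest addr0 => /esym/eqP.
(* The inner sum is a natural number to which [h] itself contributes 1, so it is nonzero in
   characteristic 0. *)
rewrite mulf_eq0 mcoeff_eq0 mp /= -natr_sum pnatr_eq0 sum_nat_seq_eq0.
by move=> /allP /(_ h hm); rewrite !eqxx.
Qed.

End HallBasis.

Theorem theorem5p41 (R : realType) (A : finType) (H : set (tree A))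
    (lt : tree A -> tree A -> Prop) (hallH : Hall_set H lt) :
  (forall f : shuffle_alg R A,
     exists! p : poly_in R H,
       shuffle_eval (fun h : H => tree_integral R (\val h)) p = f)
  /\ (exists2 phi : {lrmorphism (poly_in R H) -> shuffle_alg R A},
        (forall h : H, phi (polyvar R h) = tree_integral R (\val h))
        & bijective phi).
Proof.
set E := shuffle_eval _.
have E_inj : injective E.
  move=> p q Epq; apply/eqP; rewrite -subr_eq0; apply/eqP.
  by apply: (shuffle_eval_eq0 hallH); rewrite raddfB /= -/E Epq subrr.
have E_surj f : exists p, E p = f := shuffle_eval_surj hallH f.
split=> [f|].
  have [p Ep] := E_surj f; exists p; split=> // q Eq.
  by apply: E_inj; rewrite Ep Eq.
exists E; first exact: shuffle_eval_var.
have [g Eg] := choice E_surj.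
by exists g => // p; apply: E_inj; rewrite Eg.
Qed.
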